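(* In the calculus $\mathrm{CAU}^-_\sigma$, the rewriting relation $\to_\sigma \cup \to_\tau$ (acting on terms, trails and substitutions, closed under all contexts) is terminating and confluent.
   Context: The calculus $\mathrm{CAU}^-_\sigma$ (untyped Calculus of Audited Units with explicit substitutions) uses nameless (de Bruijn) syntax with three mutually defined categories: Terms $M,N ::= 1 \mid \lambda.M \mid M\,N \mid \mathsf{let}(M,N) \mid !_q M \mid q \triangleright M \mid \iota(\vartheta) \mid M[s] \mid \mathrm{er}(M)$; Trails $q,q' ::= \mathsf{r} \mid \mathsf{t}(q,q') \mid \mathsf{ba} \mid \mathsf{bb} \mid \mathsf{ti} \mid \mathsf{lam}(q) \mid \mathsf{app}(q,q') \mid \mathsf{let}(q,q') \mid \mathsf{tr}(\zeta) \mid \mathrm{tl}(M)$; Substitutions $s,t ::= \langle\rangle \mid {\uparrow} \mid M\cdot s \mid s\circ t$. Here $1$ is the first de Bruijn index; $\lambda$ binds index 1 of its body; $\mathsf{let}(M,N)$ binds index 1 in $N$; $\vartheta=\{M_1,\dots,M_9\}$ is a family of nine terms indexed by the nine trail constructors in the order $\mathsf{r},\mathsf{t},\mathsf{ba},\mathsf{bb},\mathsf{ti},\mathsf{lam},\mathsf{app},\mathsf{let},\mathsf{tr}$, and $\zeta=\{q_1,\dots,q_9\}$ is likewise a family of nine trails. $!_qM$ is an audited unit with history $q$, $q\triangleright M$ a term annotated with a local trail, $\iota(\vartheta)$ a trail inspection, $M[s]$ an explicit substitution, $\mathrm{er}(M)$ explicit trail erasure, $\mathrm{tl}(M)$ explicit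 trail extraction; $\langle\rangle$ is the identity substitution, ${\uparrow}$ the shift, $\cdot$ cons, $\circ$ composition. ${\uparrow}^n$ denotes ${\uparrow}\circ\cdots\circ{\uparrow}$ ($n$ times), and $1[{\uparrow}^n]$ represents index $n+1$. $\sigma$-rules: $1[\langle\rangle]\to 1$; $1[M\cdot s]\to M$; $(\lambda.M)[s]\to \lambda.(M[1\cdot(s\circ{\uparrow})])$; $(M\,N)[s]\to M[s]\,N[s]$; $(!_qM)[s]\to !_q(M[s])$; $\mathsf{let}(M,N)[s]\to\mathsf{let}(M[s],N[1\cdot(s\circ{\uparrow})])$; $(q\triangleright M)[s]\to q\triangleright(M[s])$; $\iota(\{M_1,\dots,M_9\})[s]\to\iota(\{M_1[s],\dots,M_9[s]\})$; $M[s][t]\to M[s\circ t]$; $\langle\rangle\circ s\to s$; ${\uparrow}\circ\langle\rangle\to{\uparrow}$; ${\uparrow}\circ(M\cdot s)\to s$; $(M\cdot s)\circ t\to M[t]\cdot(s\circ t)$; $(s_1\circ s_2)\circ s_3\to s_1\circ(s_2\circ s_3)$; $\mathrm{er}(1)\to 1$; $\mathrm{er}(1[{\uparrow}^n])\to 1[{\uparrow}^n]$; $\mathrm{er}(\lambda.M)\to\lambda.\mathrm{er}(M)$; $\mathrm{er}(M\,N)\to\mathrm{er}(M)\,\mathrm{er}(N)$; $\mathrm{er}(!_qM)\to !_qM$; $\mathrm{er}(\mathsf{let}(M,N))\to\mathsf{let}(\mathrm{er}(M),\mathrm{er}(N))$; $\mathrm{er}(q\triangleright M)\to\mathrm{er}(M)$;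 $\mathrm{er}(\iota(\{M_i\}))\to\iota(\{\mathrm{er}(M_i)\})$; $\mathrm{tl}(1)\to\mathsf{r}$; $\mathrm{tl}(1[{\uparrow}^n])\to\mathsf{r}$; $\mathrm{tl}(\lambda.M)\to\mathsf{lam}(\mathrm{tl}(M))$; $\mathrm{tl}(M\,N)\to\mathsf{app}(\mathrm{tl}(M),\mathrm{tl}(N))$; $\mathrm{tl}(!_qM)\to\mathsf{r}$; $\mathrm{tl}(\mathsf{let}(M,N))\to\mathsf{let}(\mathrm{tl}(M),\mathrm{tl}(N))$; $\mathrm{tl}(q\triangleright M)\to\mathsf{t}(q,\mathrm{tl}(M))$; $\mathrm{tl}(\iota(\{M_i\}))\to\mathsf{tr}(\{\mathrm{tl}(M_i)\})$. $\tau$-rules: $\mathsf{r}\triangleright M\to M$; $q\triangleright(q'\triangleright M)\to\mathsf{t}(q,q')\triangleright M$; $!_q(q'\triangleright M)\to !_{\mathsf{t}(q,q')}M$; $\lambda.(q\triangleright M)\to\mathsf{lam}(q)\triangleright\lambda.M$; $(q\triangleright M)\,N\to\mathsf{app}(q,\mathsf{r})\triangleright M\,N$; $M\,(q\triangleright N)\to\mathsf{app}(\mathsf{r},q)\triangleright M\,N$; $\mathsf{let}(q\triangleright M,N)\to\mathsf{let}(q,\mathsf{r})\triangleright\mathsf{let}(M,N)$; $\mathsf{let}(M,q\triangleright N)\to\mathsf{let}(\mathsf{r},q)\triangleright\mathsf{let}(M,N)$; $\iota(\{M_1,\dots,q\triangleright M_i,\dots,M_9\})\to\mathsf{tr}(\{\mathsf{r},\dots,q,\dots,\mathsf{r}\})\triangleright\iota(\{M_1,\dots,M_9\})$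 ($q$ in position $i$); $\mathsf{t}(q,\mathsf{r})\to q$; $\mathsf{t}(\mathsf{r},q)\to q$; $\mathsf{tr}(\{\mathsf{r},\dots,\mathsf{r}\})\to\mathsf{r}$; $\mathsf{app}(\mathsf{r},\mathsf{r})\to\mathsf{r}$; $\mathsf{lam}(\mathsf{r})\to\mathsf{r}$; $\mathsf{let}(\mathsf{r},\mathsf{r})\to\mathsf{r}$; $\mathsf{t}(\mathsf{t}(q_1,q_2),q_3)\to\mathsf{t}(q_1,\mathsf{t}(q_2,q_3))$; $\mathsf{t}(\mathsf{lam}(q),\mathsf{lam}(q'))\to\mathsf{lam}(\mathsf{t}(q,q'))$; $\mathsf{t}(\mathsf{lam}(q_1),\mathsf{t}(\mathsf{lam}(q_1'),q))\to\mathsf{t}(\mathsf{lam}(\mathsf{t}(q_1,q_1')),q)$; $\mathsf{t}(\mathsf{app}(q_1,q_2),\mathsf{app}(q_1',q_2'))\to\mathsf{app}(\mathsf{t}(q_1,q_1'),\mathsf{t}(q_2,q_2'))$; $\mathsf{t}(\mathsf{app}(q_1,q_2),\mathsf{t}(\mathsf{app}(q_1',q_2'),q))\to\mathsf{t}(\mathsf{app}(\mathsf{t}(q_1,q_1'),\mathsf{t}(q_2,q_2')),q)$; the same two rules with $\mathsf{let}$ in place of $\mathsf{app}$; $\mathsf{t}(\mathsf{tr}(\{q_i\}),\mathsf{tr}(\{q_i'\}))\to\mathsf{tr}(\{\mathsf{t}(q_i,q_i')\})$; $\mathsf{t}(\mathsf{tr}(\{q_i\}),\mathsf{t}(\mathsf{tr}(\{q_i'\}),q))\to\mathsf{t}(\mathsf{tr}(\{\mathsf{t}(q_i,q_i')\}),q)$.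 Both $\sigma$- and $\tau$-rules may be applied to any subterm, subtrail or subsubstitution. *)

(* Defs.v *)
From Stdlib Require Export Relation_Operators.
From Stdlib Require Export Relations_1 Relations_2 Relations_3.

Inductive trail_ctor : Set :=
  | c_r | c_t | c_ba | c_bb | c_ti | c_lam | c_app | c_let | c_tr.

Definition trail_ctor_eq_dec (i j : trail_ctor) : {i = j} + {i <> j}.
Proof. decide equality. Defined.

(* A nine-element family is a function on the nine trail constructors, so that
   two families are the same iff their nine components are (functional
   extensionality turns componentwise equality into equality). *)
Definition upd {A : Type} (f : trail_ctor -> A) (i : trail_ctor) (a : A) :
    trail_ctor -> A :=
  fun j => if trail_ctor_eq_dec i j then a else f j.

(* Nameless syntax: [tm_one] is index 1, index n + 1 is 1 under n shifts,
   [tm_lam M] binds index 1 in M and [tm_let M N] binds index 1 in N only.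
   [tm_bang q M] is !_q M, [tm_ann q M] is q |> M, [tm_insp Ms] is iota(Ms),
   [tm_clos M s] is M[s] and [tr_tr qs] is tr(qs). *)
Inductive term : Type :=
  | tm_one : term
  | tm_lam : term -> term
  | tm_app : term -> term -> term
  | tm_let : term -> term -> term
  | tm_bang : trail -> term -> term
  | tm_ann : trail -> term -> term
  | tm_insp : (trail_ctor -> term) -> term
  | tm_clos : term -> subst -> term
  | tm_er : term -> term
with trail : Type :=
  | tr_r : trail
  | tr_t : trail -> trail -> trail
  | tr_ba : trail
  | tr_bb : trail
  | tr_ti : trail
  | tr_lam : trail -> trail
  | tr_app : trail -> trail -> trail
  | tr_let : trail -> trail -> trail
  | tr_tr : (trail_ctor -> trail) -> trail
  | tr_tl : term -> trail
with subst : Type :=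
  | sb_id : subst
  | sb_shift : subst
  | sb_cons : term -> subst -> subst
  | sb_comp : subst -> subst -> subst.

(* [shift_pow n] is the composition of [n + 1] shifts; it is bracketed to the
   right, as the associativity rule for composition dictates. *)
Fixpoint shift_pow (n : nat) : subst :=
  match n with
  | O => sb_shift
  | S m => sb_comp sb_shift (shift_pow m)
  end.

Definition sb_lift (s : subst) : subst :=
  sb_cons tm_one (sb_comp s sb_shift).

Inductive sigma_term : Relation term :=
  | sig_one_id : sigma_term (tm_clos tm_one sb_id) tm_one
  | sig_one_cons M s : sigma_term (tm_clos tm_one (sb_cons M s)) M
  | sig_lam M s :
      sigma_term (tm_clos (tm_lam M) s) (tm_lam (tm_clos M (sb_lift s)))
  | sig_app M N s :
      sigma_term (tm_clos (tm_app M N) s) (tm_app (tm_clos M s) (tm_clos N s))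
  | sig_bang q M s :
      sigma_term (tm_clos (tm_bang q M) s) (tm_bang q (tm_clos M s))
  | sig_let M N s :
      sigma_term (tm_clos (tm_let M N) s)
                 (tm_let (tm_clos M s) (tm_clos N (sb_lift s)))
  | sig_ann q M s :
      sigma_term (tm_clos (tm_ann q M) s) (tm_ann q (tm_clos M s))
  | sig_insp Ms s :
      sigma_term (tm_clos (tm_insp Ms) s)
                 (tm_insp (fun i => tm_clos (Ms i) s))
  | sig_clos M s t :
      sigma_term (tm_clos (tm_clos M s) t) (tm_clos M (sb_comp s t))
  | sig_er_one : sigma_term (tm_er tm_one) tm_one
  | sig_er_var n :
      sigma_term (tm_er (tm_clos tm_one (shift_pow n)))
                 (tm_clos tm_one (shift_pow n))
  | sig_er_lam M : sigma_term (tm_er (tm_lam M)) (tm_lam (tm_er M))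
  | sig_er_app M N :
      sigma_term (tm_er (tm_app M N)) (tm_app (tm_er M) (tm_er N))
  | sig_er_bang q M : sigma_term (tm_er (tm_bang q M)) (tm_bang q M)
  | sig_er_let M N :
      sigma_term (tm_er (tm_let M N)) (tm_let (tm_er M) (tm_er N))
  | sig_er_ann q M : sigma_term (tm_er (tm_ann q M)) (tm_er M)
  | sig_er_insp Ms :
      sigma_term (tm_er (tm_insp Ms)) (tm_insp (fun i => tm_er (Ms i))).

Inductive sigma_trail : Relation trail :=
  | sig_tl_one : sigma_trail (tr_tl tm_one) tr_r
  | sig_tl_var n : sigma_trail (tr_tl (tm_clos tm_one (shift_pow n))) tr_r
  | sig_tl_lam M : sigma_trail (tr_tl (tm_lam M)) (tr_lam (tr_tl M))
  | sig_tl_app M N :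
      sigma_trail (tr_tl (tm_app M N)) (tr_app (tr_tl M) (tr_tl N))
  | sig_tl_bang q M : sigma_trail (tr_tl (tm_bang q M)) tr_r
  | sig_tl_let M N :
      sigma_trail (tr_tl (tm_let M N)) (tr_let (tr_tl M) (tr_tl N))
  | sig_tl_ann q M : sigma_trail (tr_tl (tm_ann q M)) (tr_t q (tr_tl M))
  | sig_tl_insp Ms :
      sigma_trail (tr_tl (tm_insp Ms)) (tr_tr (fun i => tr_tl (Ms i))).

Inductive sigma_subst : Relation subst :=
  | sig_id_comp s : sigma_subst (sb_comp sb_id s) s
  | sig_shift_id : sigma_subst (sb_comp sb_shift sb_id) sb_shift
  | sig_shift_cons M s : sigma_subst (sb_comp sb_shift (sb_cons M s)) s
  | sig_cons_comp M s t :
      sigma_subst (sb_comp (sb_cons M s) t)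
                  (sb_cons (tm_clos M t) (sb_comp s t))
  | sig_comp_assoc s1 s2 s3 :
      sigma_subst (sb_comp (sb_comp s1 s2) s3) (sb_comp s1 (sb_comp s2 s3)).

Inductive tau_term : Relation term :=
  | tau_ann_r M : tau_term (tm_ann tr_r M) M
  | tau_ann_ann q q' M :
      tau_term (tm_ann q (tm_ann q' M)) (tm_ann (tr_t q q') M)
  | tau_bang_ann q q' M :
      tau_term (tm_bang q (tm_ann q' M)) (tm_bang (tr_t q q') M)
  | tau_lam_ann q M :
      tau_term (tm_lam (tm_ann q M)) (tm_ann (tr_lam q) (tm_lam M))
  | tau_app_ann_l q M N :
      tau_term (tm_app (tm_ann q M) N) (tm_ann (tr_app q tr_r) (tm_app M N))
  | tau_app_ann_r q M N :
      tau_term (tm_app M (tm_ann q N)) (tm_ann (tr_app tr_r q) (tm_app M N))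
  | tau_let_ann_l q M N :
      tau_term (tm_let (tm_ann q M) N) (tm_ann (tr_let q tr_r) (tm_let M N))
  | tau_let_ann_r q M N :
      tau_term (tm_let M (tm_ann q N)) (tm_ann (tr_let tr_r q) (tm_let M N))
  | tau_insp_ann Ms i q :
      tau_term (tm_insp (upd Ms i (tm_ann q (Ms i))))
               (tm_ann (tr_tr (upd (fun _ => tr_r) i q)) (tm_insp Ms)).

Inductive tau_trail : Relation trail :=
  | tau_t_r_r q : tau_trail (tr_t q tr_r) q
  | tau_t_r_l q : tau_trail (tr_t tr_r q) q
  | tau_tr_r : tau_trail (tr_tr (fun _ => tr_r)) tr_r
  | tau_app_r : tau_trail (tr_app tr_r tr_r) tr_r
  | tau_lam_r : tau_trail (tr_lam tr_r) tr_r
  | tau_let_r : tau_trail (tr_let tr_r tr_r) tr_r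
  | tau_t_assoc q1 q2 q3 :
      tau_trail (tr_t (tr_t q1 q2) q3) (tr_t q1 (tr_t q2 q3))
  | tau_t_lam q q' :
      tau_trail (tr_t (tr_lam q) (tr_lam q')) (tr_lam (tr_t q q'))
  | tau_t_lam_t q1 q1' q :
      tau_trail (tr_t (tr_lam q1) (tr_t (tr_lam q1') q))
                (tr_t (tr_lam (tr_t q1 q1')) q)
  | tau_t_app q1 q2 q1' q2' :
      tau_trail (tr_t (tr_app q1 q2) (tr_app q1' q2'))
                (tr_app (tr_t q1 q1') (tr_t q2 q2'))
  | tau_t_app_t q1 q2 q1' q2' q :
      tau_trail (tr_t (tr_app q1 q2) (tr_t (tr_app q1' q2') q))
                (tr_t (tr_app (tr_t q1 q1') (tr_t q2 q2')) q)
  | tau_t_let q1 q2 q1' q2' :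
      tau_trail (tr_t (tr_let q1 q2) (tr_let q1' q2'))
                (tr_let (tr_t q1 q1') (tr_t q2 q2'))
  | tau_t_let_t q1 q2 q1' q2' q :
      tau_trail (tr_t (tr_let q1 q2) (tr_t (tr_let q1' q2') q))
                (tr_t (tr_let (tr_t q1 q1') (tr_t q2 q2')) q)
  | tau_t_tr qs qs' :
      tau_trail (tr_t (tr_tr qs) (tr_tr qs'))
                (tr_tr (fun i => tr_t (qs i) (qs' i)))
  | tau_t_tr_t qs qs' q :
      tau_trail (tr_t (tr_tr qs) (tr_t (tr_tr qs') q))
                (tr_t (tr_tr (fun i => tr_t (qs i) (qs' i))) q).

(* One-step closure under all contexts of three relations of root contractions,
   one for each syntactic category. *)
Inductive ctx_term (Rt : Relation term) (Rq : Relation trail)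
    (Rs : Relation subst) : Relation term :=
  | ctx_term_root M M' : Rt M M' -> ctx_term Rt Rq Rs M M'
  | ctx_lam M M' :
      ctx_term Rt Rq Rs M M' -> ctx_term Rt Rq Rs (tm_lam M) (tm_lam M')
  | ctx_app_l M M' N :
      ctx_term Rt Rq Rs M M' -> ctx_term Rt Rq Rs (tm_app M N) (tm_app M' N)
  | ctx_app_r M N N' :
      ctx_term Rt Rq Rs N N' -> ctx_term Rt Rq Rs (tm_app M N) (tm_app M N')
  | ctx_let_l M M' N :
      ctx_term Rt Rq Rs M M' -> ctx_term Rt Rq Rs (tm_let M N) (tm_let M' N)
  | ctx_let_r M N N' :
      ctx_term Rt Rq Rs N N' -> ctx_term Rt Rq Rs (tm_let M N) (tm_let M N')
  | ctx_bang_l q q' M :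
      ctx_trail Rt Rq Rs q q' -> ctx_term Rt Rq Rs (tm_bang q M) (tm_bang q' M)
  | ctx_bang_r q M M' :
      ctx_term Rt Rq Rs M M' -> ctx_term Rt Rq Rs (tm_bang q M) (tm_bang q M')
  | ctx_ann_l q q' M :
      ctx_trail Rt Rq Rs q q' -> ctx_term Rt Rq Rs (tm_ann q M) (tm_ann q' M)
  | ctx_ann_r q M M' :
      ctx_term Rt Rq Rs M M' -> ctx_term Rt Rq Rs (tm_ann q M) (tm_ann q M')
  | ctx_insp Ms i M' :
      ctx_term Rt Rq Rs (Ms i) M' ->
      ctx_term Rt Rq Rs (tm_insp Ms) (tm_insp (upd Ms i M'))
  | ctx_clos_l M M' s :
      ctx_term Rt Rq Rs M M' -> ctx_term Rt Rq Rs (tm_clos M s) (tm_clos M' s)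
  | ctx_clos_r M s s' :
      ctx_subst Rt Rq Rs s s' -> ctx_term Rt Rq Rs (tm_clos M s) (tm_clos M s')
  | ctx_er M M' :
      ctx_term Rt Rq Rs M M' -> ctx_term Rt Rq Rs (tm_er M) (tm_er M')
with ctx_trail (Rt : Relation term) (Rq : Relation trail)
    (Rs : Relation subst) : Relation trail :=
  | ctx_trail_root q q' : Rq q q' -> ctx_trail Rt Rq Rs q q'
  | ctx_t_l q1 q1' q2 :
      ctx_trail Rt Rq Rs q1 q1' -> ctx_trail Rt Rq Rs (tr_t q1 q2) (tr_t q1' q2)
  | ctx_t_r q1 q2 q2' :
      ctx_trail Rt Rq Rs q2 q2' -> ctx_trail Rt Rq Rs (tr_t q1 q2) (tr_t q1 q2')
  | ctx_trlam q q' :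
      ctx_trail Rt Rq Rs q q' -> ctx_trail Rt Rq Rs (tr_lam q) (tr_lam q')
  | ctx_trapp_l q1 q1' q2 :
      ctx_trail Rt Rq Rs q1 q1' ->
      ctx_trail Rt Rq Rs (tr_app q1 q2) (tr_app q1' q2)
  | ctx_trapp_r q1 q2 q2' :
      ctx_trail Rt Rq Rs q2 q2' ->
      ctx_trail Rt Rq Rs (tr_app q1 q2) (tr_app q1 q2')
  | ctx_trlet_l q1 q1' q2 :
      ctx_trail Rt Rq Rs q1 q1' ->
      ctx_trail Rt Rq Rs (tr_let q1 q2) (tr_let q1' q2)
  | ctx_trlet_r q1 q2 q2' :
      ctx_trail Rt Rq Rs q2 q2' ->
      ctx_trail Rt Rq Rs (tr_let q1 q2) (tr_let q1 q2')
  | ctx_tr qs i q' :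
      ctx_trail Rt Rq Rs (qs i) q' ->
      ctx_trail Rt Rq Rs (tr_tr qs) (tr_tr (upd qs i q'))
  | ctx_tl M M' :
      ctx_term Rt Rq Rs M M' -> ctx_trail Rt Rq Rs (tr_tl M) (tr_tl M')
with ctx_subst (Rt : Relation term) (Rq : Relation trail)
    (Rs : Relation subst) : Relation subst :=
  | ctx_subst_root s s' : Rs s s' -> ctx_subst Rt Rq Rs s s'
  | ctx_cons_l M M' s :
      ctx_term Rt Rq Rs M M' -> ctx_subst Rt Rq Rs (sb_cons M s) (sb_cons M' s)
  | ctx_cons_r M s s' :
      ctx_subst Rt Rq Rs s s' -> ctx_subst Rt Rq Rs (sb_cons M s) (sb_cons M s')
  | ctx_comp_l s s' t :
      ctx_subst Rt Rq Rs s s' -> ctx_subst Rt Rq Rs (sb_comp s t) (sb_comp s' t)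
  | ctx_comp_r s t t' :
      ctx_subst Rt Rq Rs t t' -> ctx_subst Rt Rq Rs (sb_comp s t) (sb_comp s t').

Definition no_rule : Relation subst := fun _ _ => False.

Definition step_sigma_term := ctx_term sigma_term sigma_trail sigma_subst.
Definition step_sigma_trail := ctx_trail sigma_term sigma_trail sigma_subst.
Definition step_sigma_subst := ctx_subst sigma_term sigma_trail sigma_subst.

(* No tau-rule contracts a substitution at its root. *)
Definition step_tau_term := ctx_term tau_term tau_trail no_rule.
Definition step_tau_trail := ctx_trail tau_term tau_trail no_rule.
Definition step_tau_subst := ctx_subst tau_term tau_trail no_rule.

(* Main.v *)
(**
  Termination is Zantema's semantic labelling followed by a lexicographic path
  order.  A weight, weakly decreasing along every step, is multiplicative on
  closures and compositions and additive on annotations and [tr_t].  Each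
  closure, composition and [tr_t] is labelled with its own weight.  Pushing a
  substitution under a binder then strictly decreases the label, because a
  binder multiplies the weight by 10 while lifting a substitution does not
  change its weight; and fusing two equal trail constructors under [tr_t] saves
  one constructor, hence also decreases the label.  The remaining rules are
  oriented by a precedence that puts substitution above [tm_er] and [tr_tl],
  these above the term constructors, these above annotations, these above
  [tr_t], and [tr_t] above the other trail constructors.

  Confluence follows by Newman's lemma from the convergence of all critical
  pairs.
*)
Require Import Defs.
From Stdlib Require Import List Arith Lia Wellfounded.
From Stdlib Require Import FunctionalExtensionality PropExtensionality.
From Stdlib Require Import Relations_2_facts Relations_3_facts.
Import ListNotations.

(** * Lexicographic path order *)

Section PathOrder.
Context {A : Type} (prec : A -> A -> Prop).

Inductive tree : Type := Node : A -> list tree -> tree.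

(** [lpo s t] reads as [s] above [t]. Symbols have no fixed arity, so [lex_head] asks for tails of
    equal length: comparable lists then have the same length, without which the lexicographic order
    would not be well founded. *)
Inductive lpo : tree -> tree -> Prop :=
  | lpo_sub_eq f ss t : In t ss -> lpo (Node f ss) t
  | lpo_sub f ss s t : In s ss -> lpo s t -> lpo (Node f ss) t
  | lpo_prec f g ss ts :
      prec g f -> (forall t, In t ts -> lpo (Node f ss) t) ->
      lpo (Node f ss) (Node g ts)
  | lpo_lex f ss ts :
      lex ss ts -> (forall t, In t ts -> lpo (Node f ss) t) ->
      lpo (Node f ss) (Node f ts)
with lex : list tree -> list tree -> Prop :=
  | lex_head s t ss ts :
      lpo s t -> length ss = length ts -> lex (s :: ss) (t :: ts)
  | lex_tail s ss ts : lex ss ts -> lex (s :: ss) (s :: ts).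

Let below s t := lpo t s.
(** Demanding accessible entries in the smaller list allows induction along the lexicographic order
    before all trees are known to be accessible. *)
Let lex_below ts ss := lex ss ts /\ Forall (Acc below) ts.

(** Induction on the length, then on the accessibility of the head, then on that of the tail: a
    smaller head permits any new tail with accessible entries, while an unchanged head forces a
    smaller tail. *)
Lemma lex_below_acc n ss :
  length ss = n -> Forall (Acc below) ss -> Acc lex_below ss.
Proof.
  revert ss; induction n as [|n IHn]; intros [|s ss]; try discriminate.
  - intros _ _; constructor; intros ts [H _]; inversion H.
  - intros Hlen H; injection Hlen as Hlen.
    pose proof (Forall_inv H) as Hs; pose proof (Forall_inv_tail H) as Hss.
    clear H; revert ss Hlen Hss; induction Hs as [s Hs IHs]; intros ss Hlen Hss.
    pose proof (IHn ss Hlen Hss) as Hacc.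
    induction Hacc as [ss _ IHss].
    constructor; intros ts [H Hts].
    inversion H as [? t ? ts' Hst Hl | ? ? ts' Hlex]; subst;
      inversion Hts; subst.
    + apply IHs; [exact Hst | congruence | assumption].
    + apply IHss; [split; assumption | | assumption].
      clear -Hlex; induction Hlex; simpl; congruence.
Qed.

(** A node is accessible once its arguments are, by nested induction on its symbol, on its argument
    list along [lex_below], and on the derivation of the comparison. Structural recursion over trees
    then discharges the assumption on the arguments. *)
Lemma lpo_wf : well_founded prec -> forall t, Acc below t.
Proof.
  intros wf.
  assert (Hnode : forall f ss, Forall (Acc below) ss -> Acc below (Node f ss)).
  { intros f; induction (wf f) as [f _ IHf]; intros ss Hss.
    pose proof (lex_below_acc _ ss eq_refl Hss) as Hlex.
    induction Hlex as [ss _ IHss].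
    constructor; intros t Ht; unfold below in Ht.
    remember (Node f ss) as u eqn:Hu; revert Hu.
    induction Ht as [f' ss' t Hin | f' ss' s t Hin Hst _
      | f' g ss' ts Hg _ IH | f' ss' ts Hl _ IH];
      intros Hu; injection Hu as -> ->; rewrite Forall_forall in Hss.
    - auto.
    - exact (Acc_inv (Hss _ Hin) Hst).
    - apply IHf; [assumption | rewrite Forall_forall; intros; apply IH; auto].
    - assert (Hts : Forall (Acc below) ts)
        by (rewrite Forall_forall; intros; apply IH; auto).
      apply IHss; [split; assumption | assumption]. }
  fix IH 1; intros [f ss]; apply Hnode.
  induction ss as [|s ss IHss]; constructor; [apply IH | exact IHss].
Qed.
End PathOrder.
Arguments tree : clear implicits.

(** * Termination *)

Definition sym_lt := slexprod nat nat lt lt.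

Lemma sym_lt_wf : well_founded sym_lt.
Proof. apply wf_slexprod; apply lt_wf. Qed.

Definition ctors := [c_r; c_t; c_ba; c_bb; c_ti; c_lam; c_app; c_let; c_tr].

Definition fam_list {A} (f : trail_ctor -> A) := map f ctors.

Definition fam_sum (f : trail_ctor -> nat) := list_sum (fam_list f).

(* The factor 10 pays for moving an annotation out of [tm_insp]: that creates
   one [tr_tr] and eight [tr_r], of weight 9 <= 9 * w_trail q. *)
Fixpoint w_term (M : term) : nat :=
  match M with
  | tm_one => 1
  | tm_lam M => 10 * w_term M
  | tm_app M N => 10 * (w_term M + w_term N)
  | tm_let M N => 10 * (w_term M + w_term N)
  | tm_bang q M => w_term M
  | tm_ann q M => w_trail q + w_term M
  | tm_insp Ms => 10 * fam_sum (fun i => w_term (Ms i))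
  | tm_clos M s => w_term M * w_subst s
  | tm_er M => w_term M
  end
with w_trail (q : trail) : nat :=
  match q with
  | tr_r | tr_ba | tr_bb | tr_ti => 1
  | tr_t q q' => w_trail q + w_trail q'
  | tr_lam q => 1 + w_trail q
  | tr_app q q' => 1 + w_trail q + w_trail q'
  | tr_let q q' => 1 + w_trail q + w_trail q'
  | tr_tr qs => 1 + fam_sum (fun i => w_trail (qs i))
  | tr_tl M => w_term M
  end
with w_subst (s : subst) : nat :=
  match s with
  | sb_id | sb_shift => 1
  | sb_cons M s => Nat.max (w_term M) (w_subst s)
  | sb_comp s t => w_subst s * w_subst t
  end.

Scheme term_mut := Induction for term Sort Prop
  with trail_mut := Induction for trail Sort Prop
  with subst_mut := Induction for subst Sort Prop.
Combined Scheme syntax_ind from term_mut, trail_mut, subst_mut.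

(** Positivity makes each factor at most the product containing it, as the multiplicative weights
    require. *)
Lemma w_pos :
  (forall M, 1 <= w_term M) /\ (forall q, 1 <= w_trail q) /\
  (forall s, 1 <= w_subst s).
Proof.
  apply syntax_ind; simpl; intros; try lia; try nia.
  unfold fam_sum, fam_list; simpl. specialize (H c_r). lia.
Qed.

Notation node0 c := (Node (c, 0)).

(* A symbol is a precedence class together with a label.  Closure and
   composition share a symbol, so that [sig_clos] is an associativity rule; the
   body of an annotation comes before its trail because arguments are compared
   from the left and [tau_ann_ann], [tau_bang_ann] shrink the body. *)
Fixpoint lab_term (M : term) : tree (nat * nat) :=
  match M with
  | tm_one => node0 0 []
  | tm_lam M => node0 4 [lab_term M]
  | tm_app M N | tm_let M N => node0 4 [lab_term M; lab_term N]
  | tm_bang q M | tm_ann q M => node0 3 [lab_term M; lab_trail q]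
  | tm_insp Ms => node0 4 (fam_list (fun i => lab_term (Ms i)))
  | tm_clos M s =>
      Node (6, w_term M * w_subst s) [lab_term M; lab_subst s]
  | tm_er M => node0 5 [lab_term M]
  end
with lab_trail (q : trail) : tree (nat * nat) :=
  match q with
  | tr_r | tr_ba | tr_bb | tr_ti => node0 0 []
  | tr_t q q' => Node (2, w_trail q + w_trail q') [lab_trail q; lab_trail q']
  | tr_lam q => node0 1 [lab_trail q]
  | tr_app q q' | tr_let q q' => node0 1 [lab_trail q; lab_trail q']
  | tr_tr qs => node0 1 (fam_list (fun i => lab_trail (qs i)))
  | tr_tl M => node0 5 [lab_term M]
  end
with lab_subst (s : subst) : tree (nat * nat) :=
  match s with
  | sb_id | sb_shift => node0 0 []
  | sb_cons M s => node0 1 [lab_term M; lab_subst s]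
  | sb_comp s t =>
      Node (6, w_subst s * w_subst t) [lab_subst s; lab_subst t]
  end.

Notation gt_tree := (lpo sym_lt).

(** * Comparison of labelled trees *)

Lemma gt_class c c' l l' ss ts :
  c' < c -> Forall (gt_tree (Node (c, l) ss)) ts ->
  gt_tree (Node (c, l) ss) (Node (c', l') ts).
Proof.
  intros H Hts; rewrite Forall_forall in Hts.
  apply lpo_prec; [left|]; assumption.
Qed.

Lemma gt_label c l l' ss ts :
  l' < l -> Forall (gt_tree (Node (c, l) ss)) ts ->
  gt_tree (Node (c, l) ss) (Node (c, l') ts).
Proof.
  intros H Hts; rewrite Forall_forall in Hts.
  apply lpo_prec; [right|]; assumption.
Qed.

(** A weak decrease of the label suffices: a strict one is decided by the precedence, an equality by
    the arguments. *)
Lemma gt_lex c l l' ss ts :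
  l' <= l -> lex sym_lt ss ts -> Forall (gt_tree (Node (c, l) ss)) ts ->
  gt_tree (Node (c, l) ss) (Node (c, l') ts).
Proof.
  intros H Hlex Hts; destruct (Nat.eq_dec l' l) as [->|].
  - rewrite Forall_forall in Hts; apply lpo_lex; assumption.
  - apply gt_label; [lia | assumption].
Qed.

Lemma gt_arg f ss1 ss2 s t :
  gt_tree s t -> gt_tree (Node f (ss1 ++ s :: ss2)) t.
Proof.
  intros H; apply lpo_sub with s; [apply in_elt | assumption].
Qed.

(** This absorbs the decreasing rules of semantic labelling: a step in an argument may also lower
    the label above it. *)
Lemma gt_ctx c l l' ss1 ss2 s t :
  l' <= l -> gt_tree s t ->
  gt_tree (Node (c, l) (ss1 ++ s :: ss2)) (Node (c, l') (ss1 ++ t :: ss2)).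
Proof.
  intros Hl H; apply gt_lex; [assumption | |].
  - induction ss1; [apply lex_head; auto | apply lex_tail; assumption].
  - rewrite Forall_forall; intros u Hu.
    rewrite in_app_iff in Hu; destruct Hu as [Hu | [<- | Hu]].
    + apply lpo_sub_eq, in_or_app; auto.
    + apply gt_arg; assumption.
    + apply lpo_sub_eq, in_or_app; simpl; auto.
Qed.

(** The weak inequality accompanies the strict one because labels higher up are computed from
    weights; only the pair is preserved by contexts. *)
Definition dec_term M M' :=
  gt_tree (lab_term M) (lab_term M') /\ w_term M' <= w_term M.
Definition dec_trail q q' :=
  gt_tree (lab_trail q) (lab_trail q') /\ w_trail q' <= w_trail q.
Definition dec_subst s s' :=
  gt_tree (lab_subst s) (lab_subst s') /\ w_subst s' <= w_subst s.

Lemma in_ctors i : In i ctors.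
Proof. destruct i; simpl; tauto. Qed.

Lemma fam_sum_add f g : fam_sum (fun i => f i + g i) = fam_sum f + fam_sum g.
Proof. unfold fam_sum, fam_list; induction ctors; simpl; lia. Qed.

Lemma fam_sum_mul f c : fam_sum (fun i => f i * c) = fam_sum f * c.
Proof. unfold fam_sum, fam_list; induction ctors; simpl; lia. Qed.

Lemma fam_sum_ge f i : f i <= fam_sum f.
Proof. unfold fam_sum, fam_list; destruct i; simpl; lia. Qed.

Lemma upd_eq {A} (f : trail_ctor -> A) i a : upd f i a i = a.
Proof. unfold upd; destruct (trail_ctor_eq_dec i i); congruence. Qed.

Lemma upd_neq {A} (f : trail_ctor -> A) i j a : i <> j -> upd f i a j = f j.
Proof. unfold upd; destruct (trail_ctor_eq_dec i j); congruence. Qed.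

Lemma upd_map {A B} (g : A -> B) f i a :
  (fun j => g (upd f i a j)) = upd (fun k => g (f k)) i (g a).
Proof.
  extensionality j; unfold upd; destruct (trail_ctor_eq_dec i j); congruence.
Qed.

Lemma fam_sum_upd f i a : fam_sum (upd f i a) + f i = fam_sum f + a.
Proof. destruct i; unfold fam_sum, fam_list, upd; simpl; lia. Qed.

Lemma map_ctors_split i : exists cs1 cs2,
  ctors = cs1 ++ i :: cs2 /\ ~ In i cs1 /\ ~ In i cs2.
Proof.
  assert (Hnd : NoDup ctors) by (repeat constructor; simpl; intuition discriminate).
  destruct (in_split _ _ (in_ctors i)) as (cs1 & cs2 & E).
  exists cs1, cs2; rewrite E in *.
  apply NoDup_remove in Hnd; rewrite in_app_iff in Hnd; tauto.
Qed.

Lemma gt_fam c f g i :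
  (forall j, i <> j -> f j = g j) -> gt_tree (f i) (g i) ->
  gt_tree (node0 c (fam_list f)) (node0 c (fam_list g)).
Proof.
  (* As [i] occurs only once in [ctors], the two lists agree on both sides of it. *)
  intros Hfg H; destruct (map_ctors_split i) as (cs1 & cs2 & E & H1 & H2).
  unfold fam_list; rewrite E, !map_app; simpl.
  replace (map g cs1) with (map f cs1)
    by (apply map_ext_in; intros j Hj; apply Hfg; congruence).
  replace (map g cs2) with (map f cs2)
    by (apply map_ext_in; intros j Hj; apply Hfg; congruence).
  apply gt_ctx; auto.
Qed.

Lemma in_fam {A B} (g : A -> B) f i : In (g (f i)) (fam_list (fun j => g (f j))).
Proof. exact (in_map (fun j => g (f j)) _ _ (in_ctors i)). Qed.

Lemma forall_fam {A} (P : A -> Prop) f : (forall i, P (f i)) -> Forall P (fam_list f).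
Proof. intros H; apply Forall_map, Forall_forall; auto. Qed.

#[local] Arguments fam_list {A} f : simpl never.
#[local] Arguments Nat.mul : simpl never.
#[local] Arguments Nat.max : simpl never.

(** * Decrease along contexts and rules *)

Definition dec_ctx (Rt : Relation term) (Rq : Relation trail)
    (Rs : Relation subst) :=
  (forall M M', Rt M M' -> dec_term M M') /\
  (forall q q', Rq q q' -> dec_trail q q') /\
  (forall s s', Rs s s' -> dec_subst s s').

Scheme ctx_term_mut := Minimality for ctx_term Sort Prop
  with ctx_trail_mut := Minimality for ctx_trail Sort Prop
  with ctx_subst_mut := Minimality for ctx_subst Sort Prop.
Combined Scheme ctx_ind from ctx_term_mut, ctx_trail_mut, ctx_subst_mut.

(** Weights are monotone in every argument, so no label on the path to the redex grows and [gt_ctx]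
    applies at each node. *)
Lemma ctx_dec Rt Rq Rs :
  dec_ctx Rt Rq Rs ->
  dec_ctx (ctx_term Rt Rq Rs) (ctx_trail Rt Rq Rs) (ctx_subst Rt Rq Rs).
Proof.
  intros (Ht & Hq & Hs); apply ctx_ind; auto;
    unfold dec_term, dec_trail, dec_subst; intros;
    match goal with H : _ /\ _ |- _ => destruct H as [Hgt Hle] end;
    split; simpl; rewrite ?upd_map; try nia;
    try (apply (gt_fam _ _ _ i); [intros; rewrite upd_neq; auto | rewrite upd_eq; auto]);
    try (apply (gt_ctx _ _ _ [] []); [nia | assumption]);
    try (apply (gt_ctx _ _ _ [] [_]); [nia | assumption]);
    try (apply (gt_ctx _ _ _ [_] []); [nia | assumption]).
  - pose proof (fam_sum_upd (fun i => w_term (Ms i)) i (w_term M')) as E; simpl in E; lia.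
  - pose proof (fam_sum_upd (fun i => w_trail (qs i)) i (w_trail q')) as E; simpl in E; lia.
Qed.

Ltac weights :=
  repeat match goal with
  | M : term |- _ => lazymatch goal with
    | _ : 1 <= w_term M |- _ => fail | _ => pose proof (proj1 w_pos M) end
  | q : trail |- _ => lazymatch goal with
    | _ : 1 <= w_trail q |- _ => fail
    | _ => pose proof (proj1 (proj2 w_pos) q) end
  | s : subst |- _ => lazymatch goal with
    | _ : 1 <= w_subst s |- _ => fail
    | _ => pose proof (proj2 (proj2 w_pos) s) end
  end.

(** Search for an [lpo] derivation, trying in order: an immediate argument, a smaller class, a
    smaller label, a lexicographic comparison of the arguments, and descent into the first or second
    argument. *)
Ltac gt :=
  first
  [ apply lpo_sub_eq; solve [simpl; auto | apply in_fam]
  | apply gt_class; [lia | gt_all]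
  | apply gt_label; [nia | gt_all]
  | apply gt_lex; [nia | gt_lexi | gt_all]
  | eapply lpo_sub; [left; reflexivity | gt]
  | eapply lpo_sub; [right; left; reflexivity | gt] ]
with gt_all := first [apply forall_fam; intro; gt | apply Forall_nil | apply Forall_cons; [gt | gt_all]]
with gt_lexi :=
  first [ apply lex_tail; gt_lexi | apply lex_head; [gt | reflexivity] ].

Lemma w_shift_pow n : w_subst (shift_pow n) = 1.
Proof. induction n; simpl; lia. Qed.

Lemma sigma_dec : dec_ctx sigma_term sigma_trail sigma_subst.
Proof.
  repeat split; destruct H; weights; simpl;
    rewrite ?Nat.mul_1_r, ?Nat.max_r, ?fam_sum_mul, ?w_shift_pow by lia;
    try nia;
    try (pose proof (fam_sum_ge (fun i => w_term (Ms i))) as Hge; simpl in Hge);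
    try solve [gt].
  (* Case [sig_insp]: the closure of component [i] has a smaller label, because [tm_insp] multiplies
     the sum of the weights by 10. *)
  - apply gt_class; [lia|]; apply forall_fam; intros i.
    specialize (Hge i).
    pose proof (proj1 w_pos (Ms i)).
    gt.
  (* Case [sig_tl_insp]: the new [tr_tr] adds 1 to the sum, which 10 times the sum covers as soon as
     one component has positive weight. *)
  - specialize (Hge c_r). pose proof (proj1 w_pos (Ms c_r)). lia.
Qed.

Lemma tau_dec : dec_ctx tau_term tau_trail no_rule.
Proof.
  repeat split; try destruct H; weights; simpl; rewrite ?upd_map, ?fam_sum_add; try nia;
    try solve [gt].
  - apply gt_class; [lia|]; apply Forall_cons; [|apply Forall_cons; [|constructor]].
    + apply (gt_fam _ _ _ i); [intros; rewrite upd_neq; auto |].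
      rewrite upd_eq; simpl; gt.
    + apply gt_class; [lia|]; apply forall_fam; intros j.
      destruct (trail_ctor_eq_dec i j) as [<-|]; [|rewrite upd_neq by assumption; gt].
      rewrite upd_eq.
      (* The trail [q] lies inside the annotation that is the [i]-th child on the left. *)
      apply lpo_sub with (node0 3 [lab_term (Ms i); lab_trail q]); [|gt].
      apply in_map_iff; exists i; rewrite upd_eq; auto using in_ctors.
  - pose proof (fam_sum_upd (fun _ => 1) i (w_trail q)) as E1.
    pose proof (fam_sum_upd (fun i => w_term (Ms i)) i (w_trail q + w_term (Ms i))) as E2.
    change (fam_sum (fun _ => 1)) with 9 in E1; simpl in *; lia.
  (* Each fused component gets label [w_trail (qs i) + w_trail (qs' i)]. The two family sums bound
     it, and the outer label exceeds these by the two [tr_tr] nodes. *)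
  - pose proof (fam_sum_ge (fun i => w_trail (qs i))) as H1.
    pose proof (fam_sum_ge (fun i => w_trail (qs' i))) as H2.
    apply gt_class; [lia|]; apply forall_fam; intros i.
    specialize (H1 i); specialize (H2 i); simpl in *; gt.
  - pose proof (fam_sum_ge (fun i => w_trail (qs i))) as H1.
    pose proof (fam_sum_ge (fun i => w_trail (qs' i))) as H2.
    apply gt_label; [lia|]; apply Forall_cons; [|apply Forall_cons; [gt|constructor]].
    apply gt_class; [lia|]; apply forall_fam; intros i.
    specialize (H1 i); specialize (H2 i); simpl in *; gt.
Qed.

Lemma noetherian_of_dec {U A} (R : Relation U) (lt : A -> A -> Prop) (f : U -> A) :
  well_founded lt -> (forall x y, R x y -> lt (f y) (f x)) -> Noetherian U R.
Proof.
  intros wf H x; remember (f x) as a eqn:E; revert x E.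
  induction (wf a) as [a _ IH]; intros x ->; constructor; eauto.
Qed.

Notation root_term := (union term sigma_term tau_term).
Notation root_trail := (union trail sigma_trail tau_trail).
Notation red_term := (ctx_term root_term root_trail sigma_subst).
Notation red_trail := (ctx_trail root_term root_trail sigma_subst).
Notation red_subst := (ctx_subst root_term root_trail sigma_subst).

Lemma red_dec : dec_ctx red_term red_trail red_subst.
Proof.
  destruct sigma_dec as (St & Sq & Ss), tau_dec as (Tt & Tq & Ts).
  apply ctx_dec; refine (conj _ (conj _ Ss)); intros ? ? [|]; auto.
Qed.

Lemma red_noetherian :
  Noetherian term red_term /\ Noetherian trail red_trail /\
  Noetherian subst red_subst.
Proof.
  pose proof (lpo_wf sym_lt sym_lt_wf) as wf; destruct red_dec as (Ht & Hq & Hs).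
  split; [|split].
  - exact (noetherian_of_dec _ _ lab_term wf (fun M M' H => proj1 (Ht M M' H))).
  - exact (noetherian_of_dec _ _ lab_trail wf (fun q q' H => proj1 (Hq q q' H))).
  - exact (noetherian_of_dec _ _ lab_subst wf (fun s s' H => proj1 (Hs s s' H))).
Qed.

(** * Union of closures and closure of the union *)

Lemma ctx_mono (Rt Rt' : Relation term) (Rq Rq' : Relation trail)
    (Rs Rs' : Relation subst) :
  (forall M N, Rt M N -> Rt' M N) -> (forall q q', Rq q q' -> Rq' q q') ->
  (forall s t, Rs s t -> Rs' s t) ->
  (forall M N, ctx_term Rt Rq Rs M N -> ctx_term Rt' Rq' Rs' M N) /\
  (forall q q', ctx_trail Rt Rq Rs q q' -> ctx_trail Rt' Rq' Rs' q q') /\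
  (forall s t, ctx_subst Rt Rq Rs s t -> ctx_subst Rt' Rq' Rs' s t).
Proof. intros; apply ctx_ind; intros; solve [constructor; auto with nocore]. Qed.

(** A step contracts a single redex, so closing the combined root rules under contexts adds nothing.
    Stated as equalities of relations, the result permits rewriting by them. *)
Lemma red_union :
  union term step_sigma_term step_tau_term = red_term /\
  union trail step_sigma_trail step_tau_trail = red_trail /\
  union subst step_sigma_subst step_tau_subst = red_subst.
Proof.
  assert (Hto :
    (forall M N, red_term M N -> union term step_sigma_term step_tau_term M N) /\
    (forall q q', red_trail q q' -> union trail step_sigma_trail step_tau_trail q q') /\
    (forall s t, red_subst s t -> union subst step_sigma_subst step_tau_subst s t)).
  { apply ctx_ind; intros;
      match goal with
      | H : union _ _ _ _ _ |- _ => destruct H; [left | right]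
      | _ => left
      end; solve [constructor; assumption]. }
  destruct Hto as (Ht & Hq & Hs).
  destruct (ctx_mono sigma_term root_term
    sigma_trail root_trail sigma_subst sigma_subst
    (fun _ _ H => or_introl H) (fun _ _ H => or_introl H) (fun _ _ H => H))
    as (St & Sq & Ss).
  destruct (ctx_mono tau_term root_term
    tau_trail root_trail no_rule sigma_subst
    (fun _ _ H => or_intror H) (fun _ _ H => or_intror H)
    (fun _ _ H => False_ind _ H)) as (Tt & Tq & Ts).
  split; [|split]; extensionality x; extensionality y;
    apply propositional_extensionality; split.
  - intros [H|H]; [exact (St _ _ H) | exact (Tt _ _ H)].
  - apply Ht.
  - intros [H|H]; [exact (Sq _ _ H) | exact (Tq _ _ H)].
  - apply Hq.
  - intros [H|H]; [exact (Ss _ _ H) | exact (Ts _ _ H)].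
  - apply Hs.
Qed.

(** * Confluence *)

Notation join_term := (coherent term red_term).
Notation join_trail := (coherent trail red_trail).
Notation join_subst := (coherent subst red_subst).

Lemma coherent_step_l {U} (R : Relation U) x x' y :
  R x x' -> coherent U R x' y -> coherent U R x y.
Proof. intros H (z & Hx & Hy); exists z; split; [eapply Rstar_n|]; eauto. Qed.

Lemma coherent_step_r {U} (R : Relation U) x y y' :
  R y y' -> coherent U R x y' -> coherent U R x y.
Proof. intros H (z & Hx & Hy); exists z; split; [|eapply Rstar_n]; eauto. Qed.

Lemma coherent_refl {U} (R : Relation U) x : coherent U R x x.
Proof. exists x; split; apply Rstar_0. Qed.

Lemma coherent_star_l {U} (R : Relation U) x x' y :
  Rstar U R x x' -> coherent U R x' y -> coherent U R x y.
Proof. induction 1; eauto using coherent_step_l. Qed.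

Lemma coherent_star_r {U} (R : Relation U) x y y' :
  Rstar U R y y' -> coherent U R x y' -> coherent U R x y.
Proof. induction 1; eauto using coherent_step_r. Qed.

Lemma star_map {U V} (R : Relation U) (S : Relation V) (c : U -> V) a b :
  (forall a b, R a b -> S (c a) (c b)) -> Rstar U R a b -> Rstar V S (c a) (c b).
Proof.
  intros Hc; induction 1; [apply Rstar_0 | eapply Rstar_n; eauto].
Qed.

(** * Families, indices and normal forms *)

Lemma upd_same {A} (f : trail_ctor -> A) i : upd f i (f i) = f.
Proof.
  extensionality j; unfold upd; destruct (trail_ctor_eq_dec i j); congruence.
Qed.

Lemma upd_twice {A} (f : trail_ctor -> A) i a b : upd (upd f i a) i b = upd f i b.
Proof.
  extensionality j; unfold upd; destruct (trail_ctor_eq_dec i j); congruence.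
Qed.

Lemma upd_comm {A} (f : trail_ctor -> A) i j a b :
  i <> j -> upd (upd f i a) j b = upd (upd f j b) i a.
Proof.
  intros; extensionality k; unfold upd;
    destruct (trail_ctor_eq_dec i k), (trail_ctor_eq_dec j k); congruence.
Qed.

(* [tau_insp_ann] in a form whose left-hand side unifies with any family. *)
Lemma tau_insp_at Ms i q M :
  Ms i = tm_ann q M ->
  tau_term (tm_insp Ms)
    (tm_ann (tr_tr (upd (fun _ => tr_r) i q)) (tm_insp (upd Ms i M))).
Proof.
  intros E.
  replace Ms with (upd (upd Ms i M) i (tm_ann q (upd Ms i M i))) at 1.
  - apply tau_insp_ann.
  - rewrite upd_eq, upd_twice, <- E; apply upd_same.
Qed.

(** Plain inversion leaves an equation between families built by [upd]; here it becomes an equation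
    about one component. *)
Lemma red_insp_inv Ms N :
  red_term (tm_insp Ms) N ->
  (exists i q M, Ms i = tm_ann q M /\
     N = tm_ann (tr_tr (upd (fun _ => tr_r) i q)) (tm_insp (upd Ms i M))) \/
  (exists i M, red_term (Ms i) M /\ N = tm_insp (upd Ms i M)).
Proof.
  intros H; inversion H as [? ? Hr| | | | | | | | | |? i M| | | ]; subst.
  - left; destruct Hr as [Hr|Hr]; [inversion Hr|]; inversion Hr as [ | | | | | | | |Ms' i q]; subst.
    exists i, q, (Ms' i).
    rewrite upd_eq, upd_twice, upd_same; auto.
  - right; eauto.
Qed.

Lemma red_tr_inv qs q :
  red_trail (tr_tr qs) q ->
  (qs = (fun _ => tr_r) /\ q = tr_r) \/
  (exists i q', red_trail (qs i) q' /\ q = tr_tr (upd qs i q')).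
Proof.
  intros H; inversion H as [? ? Hr| | | | | | | |? i q'| ]; subst.
  - left; destruct Hr as [Hr|Hr]; inversion Hr; auto.
  - right; eauto.
Qed.

Lemma red_shift_pow_nf n s : ~ red_subst (shift_pow n) s.
Proof.
  revert s; induction n; simpl; intros s H; inversion H as [? ? Hr| | | | ]; subst.
  - inversion Hr.
  - destruct n; simpl in Hr; inversion Hr.
  - match goal with H : ctx_subst _ _ _ sb_shift _ |- _ => inversion H as [? ? Hr| | | | ] end.
    inversion Hr.
  - eapply IHn; eassumption.
Qed.

(** Hence [sig_er_var] and [sig_tl_var] have no overlap with a step inside their argument.
    Bracketing [shift_pow] to the right excludes the associativity redex. *)
Lemma red_var_nf n M : ~ red_term (tm_clos tm_one (shift_pow n)) M.
Proof.
  intros H; inversion H as [? ? Hr| | | | | | | | | | | ? ? ? Hr| ? ? ? Hr | ]; subst.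
  - destruct Hr as [Hr|Hr]; inversion Hr; destruct n; discriminate.
  - inversion Hr as [? ? Hr'| | | | | | | | | | | | | ]; destruct Hr' as [Hr'|Hr']; inversion Hr'.
  - eapply red_shift_pow_nf; eassumption.
Qed.

(** Steps under a family change one component, so the nine reductions are carried out one index
    after another. *)
Lemma star_fam {U V} (R : Relation U) (S : Relation V) (c : (trail_ctor -> U) -> V) f g :
  (forall f i a, R (f i) a -> S (c f) (c (upd f i a))) ->
  (forall i, Rstar U R (f i) (g i)) -> Rstar V S (c f) (c g).
Proof.
  intros Hc H.
  assert (Hone : forall f i a, Rstar U R (f i) a -> Rstar V S (c f) (c (upd f i a))).
  { intros f0 i a Ha; remember (f0 i) as b eqn:E; revert f0 E.
    induction Ha as [b|b b' a Hb _ IH]; intros f0 ->.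
    - rewrite upd_same; apply Rstar_0.
    - eapply Rstar_n; [apply Hc, Hb|].
      replace (upd f0 i a) with (upd (upd f0 i b') i a) by apply upd_twice.
      apply IH; symmetry; apply upd_eq. }
  (* The family [h] is the state after the indices in [l] have been treated. *)
  assert (Hl : forall l, exists h, Rstar V S (c f) (c h) /\
    forall i, h i = g i \/ h i = f i /\ ~ In i l).
  { induction l as [|i l (h & Hh & Hhi)].
    - exists f; split; [apply Rstar_0 | auto].
    - exists (upd h i (g i)); split.
      + apply Rstar_transitive with (c h); [assumption|].
        apply Hone; destruct (Hhi i) as [->|[-> _]]; [apply Rstar_0 | apply H].
      + intros j; destruct (trail_ctor_eq_dec i j) as [<-|n].
        * rewrite upd_eq; auto.
        * rewrite upd_neq by assumption; simpl.
          destruct (Hhi j) as [|[]]; [auto | right; split; [assumption | tauto]]. }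
  destruct (Hl ctors) as (h & Hh & Hhi).
  replace g with h; [assumption|].
  extensionality i; destruct (Hhi i) as [|[_ []]]; [assumption | apply in_ctors].
Qed.

Lemma star_insp Ms Ns :
  (forall i, Rstar term red_term (Ms i) (Ns i)) ->
  Rstar term red_term (tm_insp Ms) (tm_insp Ns).
Proof. apply star_fam; intros; apply ctx_insp; assumption. Qed.

Lemma star_tr qs qs' :
  (forall i, Rstar trail red_trail (qs i) (qs' i)) ->
  Rstar trail red_trail (tr_tr qs) (tr_tr qs').
Proof. apply star_fam; intros; apply ctx_tr; assumption. Qed.

Lemma star_t_tr qs qs' q :
  (forall i, Rstar trail red_trail (qs i) (qs' i)) ->
  Rstar trail red_trail (tr_t (tr_tr qs) q) (tr_t (tr_tr qs') q).
Proof.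
  intros H; apply (star_map red_trail _ (fun q' => tr_t q' q));
    [intros; apply ctx_t_l; assumption | apply star_tr, H].
Qed.

Lemma star_ann_tr qs qs' M :
  (forall i, Rstar trail red_trail (qs i) (qs' i)) ->
  Rstar term red_term (tm_ann (tr_tr qs) M) (tm_ann (tr_tr qs') M).
Proof.
  intros H; apply (star_map red_trail _ (fun q' => tm_ann q' M));
    [intros; apply ctx_ann_l; assumption | apply star_tr, H].
Qed.

(** * Automation for joining peaks *)

Ltac constr_headed t :=
  lazymatch t with
  | ?f _ => constr_headed f
  | _ => is_constructor t
  end.

(** Only steps from constructor-headed sources are inverted, so the case analysis stops at the
    metavariables of the rules. *)
Ltac invert_red :=
  repeat match goal with
  | H : red_term (tm_clos tm_one (shift_pow _)) _ |- _ => destruct (red_var_nf _ _ H)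
  | H : red_subst (shift_pow _) _ |- _ => destruct (red_shift_pow_nf _ _ H)
  | H : red_term (tm_insp _) _ |- _ =>
      apply red_insp_inv in H;
      destruct H as [(? & ? & ? & ? & ?) | (? & ? & ? & ?)]; subst
  | H : red_trail (tr_tr _) _ |- _ =>
      apply red_tr_inv in H; destruct H as [(? & ?) | (? & ? & ? & ?)]; subst
  | H : ctx_term _ _ _ ?M _ |- _ => constr_headed M; inversion H; clear H; subst
  | H : ctx_trail _ _ _ ?q _ |- _ => constr_headed q; inversion H; clear H; subst
  | H : ctx_subst _ _ _ ?s _ |- _ => constr_headed s; inversion H; clear H; subst
  | H : union _ _ _ _ _ |- _ => destruct H as [H|H]
  | H : sigma_term _ _ |- _ => inversion H; clear H; subst
  | H : sigma_trail _ _ |- _ => inversion H; clear H; subst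
  | H : sigma_subst _ _ |- _ => inversion H; clear H; subst
  | H : tau_term _ _ |- _ => inversion H; clear H; subst
  | H : tau_trail _ _ |- _ => inversion H; clear H; subst
  end.

(** Assumptions come first, so that a step in a copied subterm can be replayed in each copy.
    Components of families are not searched; there the index has to be supplied. *)
Ltac find_step :=
  first [ eassumption | lazymatch goal with
  | |- ctx_term _ _ _ ?M _ =>
      first [ apply ctx_term_root; left; constructor
            | apply ctx_term_root; right; constructor
            | lazymatch M with
              | tm_lam _ => apply ctx_lam; find_step
              | tm_app _ _ => first [apply ctx_app_l; find_step | apply ctx_app_r; find_step]
              | tm_let _ _ => first [apply ctx_let_l; find_step | apply ctx_let_r; find_step]
              | tm_bang _ _ => first [apply ctx_bang_l; find_step | apply ctx_bang_r; find_step]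
              | tm_ann _ _ => first [apply ctx_ann_l; find_step | apply ctx_ann_r; find_step]
              | tm_clos _ _ => first [apply ctx_clos_l; find_step | apply ctx_clos_r; find_step]
              | tm_er _ => apply ctx_er; find_step
              end ]
  | |- ctx_trail _ _ _ ?q _ =>
      first [ apply ctx_trail_root; left; constructor
            | apply ctx_trail_root; right; constructor
            | lazymatch q with
              | tr_t _ _ => first [apply ctx_t_l; find_step | apply ctx_t_r; find_step]
              | tr_lam _ => apply ctx_trlam; find_step
              | tr_app _ _ => first [apply ctx_trapp_l; find_step | apply ctx_trapp_r; find_step]
              | tr_let _ _ => first [apply ctx_trlet_l; find_step | apply ctx_trlet_r; find_step]
              | tr_tl _ => apply ctx_tl; find_step
              end ]
  | |- ctx_subst _ _ _ ?s _ =>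
      first [ apply ctx_subst_root; constructor
            | lazymatch s with
              | sb_cons _ _ => first [apply ctx_cons_l; find_step | apply ctx_cons_r; find_step]
              | sb_comp _ _ => first [apply ctx_comp_l; find_step | apply ctx_comp_r; find_step]
              end ]
  end ].

(* [once] keeps a failure further on from backtracking into [constructor]. *)
Ltac reduce_l := repeat (eapply coherent_step_l; [once find_step | try unfold sb_lift]).
Ltac reduce_r := repeat (eapply coherent_step_r; [once find_step | try unfold sb_lift]).
Ltac join := unfold sb_lift; solve [reduce_l; reduce_r; apply coherent_refl].
Ltac star := first [apply Rstar_0 | eapply Rstar_n; [find_step | star]].
Ltac pointwise i :=
  let j := fresh "j" in
  intros j; unfold upd; destruct (trail_ctor_eq_dec i j) as [<-|?]; star.

(** * Peaks of a root contraction against an arbitrary step *)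

Lemma peak_subst s t : sigma_subst s t -> forall u, red_subst s u -> join_subst t u.
Proof.
  intros [] u Hu; invert_red; join.
Qed.

Lemma peak_sigma_trail s t u : sigma_trail s t -> red_trail s u -> join_trail t u.
Proof.
  intros [] Hu; invert_red; try join.
  (* An annotation leaves component [x]: extraction before its removal yields [tr_t] at [x] alone,
     extraction afterwards yields [tr_t tr_r _] at the other indices, to be simplified pointwise. *)
  - eapply coherent_step_l.
    { apply ctx_tr with (i := x); rewrite H; find_step. }
    reduce_r; eapply coherent_star_r; [apply star_tr | apply coherent_refl].
    pointwise x.
  - eapply coherent_step_l; [apply ctx_tr with (i := x); find_step|].
    reduce_r; rewrite upd_map; apply coherent_refl.
Qed.

Lemma peak_sigma_term s t u : sigma_term s t -> red_term s u -> join_term t u.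
Proof.
  intros [] Hu; invert_red; try join.
  - eapply coherent_step_l.
    { apply ctx_insp with (i := x); rewrite H; find_step. }
    eapply coherent_step_l.
    { apply ctx_term_root; right; apply tau_insp_at, upd_eq. }
    reduce_r; rewrite upd_twice, (upd_map (fun N => tm_clos N _)).
    apply coherent_refl.
  - eapply coherent_step_l; [apply ctx_insp with (i := x); find_step|].
    reduce_r; rewrite (upd_map (fun N => tm_clos N _)); apply coherent_refl.
  (* The step is in the substitution, of which [sig_insp] makes nine copies. *)
  - reduce_r; eapply coherent_star_l; [apply star_insp | apply coherent_refl].
    intros i; star.
  (* Overlap of [sig_clos] with [sig_insp]: the components differ by one [sig_clos] step each. *)
  - reduce_l; eapply coherent_step_r; [find_step|].
    eapply coherent_star_r; [apply star_insp | apply coherent_refl].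
    intros i; star.
  - eapply coherent_step_l.
    { apply ctx_insp with (i := x); rewrite H; find_step. }
    reduce_r; rewrite upd_map; apply coherent_refl.
  - eapply coherent_step_l; [apply ctx_insp with (i := x); find_step|].
    reduce_r; rewrite upd_map; apply coherent_refl.
Qed.

Lemma peak_tau_trail s t u : tau_trail s t -> red_trail s u -> join_trail t u.
Proof.
  intros [] Hu; invert_red; try join.
  (* The left family consists of [tr_r] only and has collapsed; each fused component [tr_t tr_r _]
     simplifies to match. *)
  - reduce_r; eapply coherent_star_l; [apply star_tr | apply coherent_refl].
    intros i; star.
  - eapply coherent_step_l; [apply ctx_tr with (i := x); find_step|].
    reduce_r; eapply coherent_star_r; [apply star_tr | apply coherent_refl].
    pointwise x.
  - reduce_r; eapply coherent_star_l; [apply star_tr | apply coherent_refl].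
    intros i; star.
  - eapply coherent_step_l; [apply ctx_tr with (i := x); find_step|].
    reduce_r; eapply coherent_star_r; [apply star_tr | apply coherent_refl].
    pointwise x.
  - reduce_r; eapply coherent_star_l;
      [apply star_t_tr | apply coherent_refl].
    intros i; star.
  - eapply coherent_step_l.
    { apply ctx_t_l, ctx_tr with (i := x); find_step. }
    reduce_r; eapply coherent_star_r;
      [apply star_t_tr | apply coherent_refl].
    pointwise x.
  (* Three consecutive [tr_tr]: fusing the first two or the last two first agrees componentwise up
     to [tau_t_assoc]. *)
  - reduce_l; reduce_r; eapply coherent_star_l; [apply star_tr | apply coherent_refl].
    intros i; star.
  - reduce_l; reduce_r; eapply coherent_star_l;
      [apply star_t_tr | apply coherent_refl].
    intros i; star.
  - reduce_r; eapply coherent_star_l;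
      [apply star_t_tr | apply coherent_refl].
    intros i; star.
  - eapply coherent_step_l.
    { apply ctx_t_l, ctx_tr with (i := x); find_step. }
    reduce_r; eapply coherent_star_r;
      [apply star_t_tr | apply coherent_refl].
    pointwise x.
Qed.

Lemma peak_tau_term s t u : tau_term s t -> red_term s u -> join_term t u.
Proof.
  intros [] Hu; invert_red; try join.
  - destruct (trail_ctor_eq_dec i x) as [<-|n].
    { rewrite upd_eq in H; injection H as <- <-.
      rewrite upd_twice, upd_same; apply coherent_refl. }
    rewrite upd_neq in H by assumption.
    eapply coherent_step_l.
    { apply ctx_ann_r, ctx_term_root; right; apply tau_insp_at, H. }
    eapply coherent_step_r.
    { apply ctx_ann_r, ctx_term_root; right; apply tau_insp_at with (i := i).
      rewrite upd_neq, upd_eq by congruence; reflexivity. }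
    rewrite (upd_comm Ms), upd_twice, (upd_comm _ x i), upd_same by congruence.
    reduce_l; reduce_r.
    (* Two distinct components are annotated. Whichever leaves first, the fused trail reduces to the
       family holding both trails and [tr_r] elsewhere. *)
    eapply coherent_star_l; [apply star_ann_tr with (qs' := upd (upd (fun _ => tr_r) i q) x x0) | ].
    { intros j; unfold upd;
        destruct (trail_ctor_eq_dec i j), (trail_ctor_eq_dec x j); first [congruence | star]. }
    eapply coherent_star_r; [apply star_ann_tr | apply coherent_refl].
    { intros j; unfold upd;
        destruct (trail_ctor_eq_dec i j), (trail_ctor_eq_dec x j); first [congruence | star]. }
  - destruct (trail_ctor_eq_dec i x) as [<-|n].
    + rewrite upd_eq in H; rewrite upd_twice. invert_red.
      * rewrite (upd_same Ms), (upd_same (fun _ => tr_r)); join.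
      * eapply coherent_step_l.
        { apply ctx_ann_r, ctx_term_root; right; apply tau_insp_at; eauto. }
        eapply coherent_step_r.
        { apply ctx_term_root; right; apply tau_insp_at, upd_eq. }
        reduce_l; rewrite upd_twice.
        eapply coherent_star_l; [apply star_ann_tr | apply coherent_refl].
        pointwise i.
      * eapply coherent_step_l.
        { apply ctx_ann_l, ctx_tr with (i := i); rewrite upd_eq; eassumption. }
        eapply coherent_step_r.
        { apply ctx_term_root; right; apply tau_insp_at, upd_eq. }
        rewrite !upd_twice, upd_same; apply coherent_refl.
      * eapply coherent_step_l.
        { apply ctx_ann_r, ctx_insp; eassumption. }
        eapply coherent_step_r.
        { apply ctx_term_root; right; apply tau_insp_at, upd_eq. }
        rewrite upd_twice; apply coherent_refl.
    + rewrite upd_neq in H by assumption.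
      eapply coherent_step_l; [apply ctx_ann_r, ctx_insp; eassumption|].
      eapply coherent_step_r.
      { apply ctx_term_root; right; apply tau_insp_at with (i := i).
        rewrite upd_neq, upd_eq by congruence; reflexivity. }
      rewrite (upd_comm Ms), upd_twice, (upd_comm Ms), upd_same by congruence.
      apply coherent_refl.
Qed.

Lemma peak_term s t : root_term s t -> forall u, red_term s u -> join_term t u.
Proof. intros [H|H] u; [eapply peak_sigma_term | eapply peak_tau_term]; exact H. Qed.

Lemma peak_trail s t : root_trail s t -> forall u, red_trail s u -> join_trail t u.
Proof. intros [H|H] u; [eapply peak_sigma_trail | eapply peak_tau_trail]; exact H. Qed.

(** * Local confluence *)

Lemma coherent_map {U V} (R : Relation U) (S : Relation V) (c : U -> V) a b :
  (forall a b, R a b -> S (c a) (c b)) ->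
  coherent U R a b -> coherent V S (c a) (c b).
Proof.
  intros Hc (z & Ha & Hb); exists (c z); split; eapply star_map; eauto.
Qed.

Lemma coherent_swap {U} (R : Relation U) a b : coherent U R a b -> coherent U R b a.
Proof. intros (z & Ha & Hb); exists z; auto. Qed.

Ltac from_peak :=
  apply coherent_swap; first
  [ eapply peak_term; [eassumption|] | eapply peak_trail; [eassumption|]
  | eapply peak_subst; [eassumption|] ]; constructor; assumption.

Ltac from_child :=
  match goal with
  | IH : forall z, ctx_term _ _ _ ?x z -> coherent _ _ ?y z, H : ctx_term _ _ _ ?x ?z
    |- coherent _ _ ?Y _ =>
    match eval pattern y in Y with ?c _ => apply (coherent_map red_term _ c y z) end
  | IH : forall z, ctx_trail _ _ _ ?x z -> coherent _ _ ?y z, H : ctx_trail _ _ _ ?x ?z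
    |- coherent _ _ ?Y _ =>
    match eval pattern y in Y with ?c _ => apply (coherent_map red_trail _ c y z) end
  | IH : forall z, ctx_subst _ _ _ ?x z -> coherent _ _ ?y z, H : ctx_subst _ _ _ ?x ?z
    |- coherent _ _ ?Y _ =>
    match eval pattern y in Y with ?c _ => apply (coherent_map red_subst _ c y z) end
  end; [intros; constructor; assumption | auto].

(** Induction on the position of the first step. Root contractions on either side are covered by the
    peak lemmas, steps in different children commute, and steps in the same child are joined there
    and lifted by [coherent_map]. *)
Lemma red_local_confluence :
  (forall M M', red_term M M' -> forall N, red_term M N -> join_term M' N) /\
  (forall q q', red_trail q q' -> forall p, red_trail q p -> join_trail q' p) /\
  (forall s s', red_subst s s' -> forall t, red_subst s t -> join_subst s' t).
Proof.
  apply ctx_ind; intros;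
    try (eapply peak_term; eassumption); try (eapply peak_trail; eassumption);
    try (eapply peak_subst; eassumption);
    match goal with Hz : _ |- coherent _ _ _ ?z => match type of Hz with _ z => rename Hz into Hlast end end.
  all: try solve [inversion Hlast; subst; first [from_peak | join | from_child]].
  - apply red_insp_inv in Hlast.
    destruct Hlast as [(j & q & M & E & ->) | (j & M & Hj & ->)].
    + apply coherent_swap; eapply peak_term;
        [right; apply tau_insp_at, E | apply ctx_insp; assumption].
    + destruct (trail_ctor_eq_dec i j) as [<-|n].
      * apply (coherent_map red_term _ (fun a => tm_insp (upd Ms i a))); [|auto].
        intros a b Hab; rewrite <- (upd_twice Ms i a b); apply ctx_insp.
        rewrite upd_eq; assumption.
      * eapply coherent_step_l; [apply ctx_insp with (i := j)|];
          [rewrite upd_neq by assumption; eassumption|].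
        eapply coherent_step_r; [apply ctx_insp with (i := i)|];
          [rewrite upd_neq by congruence; eassumption|].
        rewrite upd_comm by assumption; apply coherent_refl.
  - apply red_tr_inv in Hlast.
    (* If the family collapses by [tau_tr_r], the first step would start from [tr_r], which is
       normal. *)
    destruct Hlast as [(-> & ->) | (j & q & Hj & ->)]; [invert_red|].
    destruct (trail_ctor_eq_dec i j) as [<-|n].
    + apply (coherent_map red_trail _ (fun a => tr_tr (upd qs i a))); [|auto].
      intros a b Hab; rewrite <- (upd_twice qs i a b); apply ctx_tr.
      rewrite upd_eq; assumption.
    + eapply coherent_step_l; [apply ctx_tr with (i := j)|];
        [rewrite upd_neq by assumption; eassumption|].
      eapply coherent_step_r; [apply ctx_tr with (i := i)|];
        [rewrite upd_neq by congruence; eassumption|].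
      rewrite upd_comm by assumption; apply coherent_refl.
Qed.

Theorem theorem1 :
  (Noetherian term (union term step_sigma_term step_tau_term) /\
   Noetherian trail (union trail step_sigma_trail step_tau_trail) /\
   Noetherian subst (union subst step_sigma_subst step_tau_subst)) /\
  (Confluent term (union term step_sigma_term step_tau_term) /\
   Confluent trail (union trail step_sigma_trail step_tau_trail) /\
   Confluent subst (union subst step_sigma_subst step_tau_subst)).
Proof.
  destruct red_union as (-> & -> & ->).
  destruct red_noetherian as (Nt & Nq & Ns).
  destruct red_local_confluence as (Ct & Cq & Cs).
  split; [auto|].
  split; [|split]; apply Newman; try assumption; intros x y z Hy Hz.
  - exact (Ct _ _ Hy _ Hz).
  - exact (Cq _ _ Hy _ Hz).
  - exact (Cs _ _ Hy _ Hz).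
Qed.
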